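(* Let $\mathbb{K}$ be a field whose characteristic $p$ belongs to $\{2,3\}$, and let $n\geq 1$ be an integer. Then every matrix of $\mathrm{M}_n(\mathbb{K})$ which is a sum of (finitely many) idempotent matrices of $\mathrm{M}_n(\mathbb{K})$ is actually a sum of four idempotent matrices of $\mathrm{M}_n(\mathbb{K})$.
   Context: An idempotent matrix is a matrix $Q\in \mathrm{M}_n(\mathbb{K})$ with $Q^2=Q$ (the zero matrix and the identity matrix are idempotents). *)

(* Defs.v *)
From mathcomp Require Import all_boot all_order all_algebra.

Set Implicit Arguments.
Unset Strict Implicit.
Unset Printing Implicit Defensive.

Import GRing.Theory.
Local Open Scope ring_scope.

Definition idempotent_mx (K : fieldType) (n : nat) (Q : 'M[K]_n) : Prop :=
  Q *m Q = Q.

(* The summands need not be distinct, and 0 is idempotent, so "sum of k" also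
   covers "sum of at most k"; for k = 0 only A = 0 qualifies. *)
Definition sum_of_idempotents (K : fieldType) (n k : nat) (A : 'M[K]_n) : Prop :=
  exists Q : 'I_k -> 'M[K]_n,
    (forall i, idempotent_mx (Q i)) /\ A = \sum_(i < k) Q i.

(* Main.v *)
Require Import Defs.
From mathcomp Require Import all_boot all_order all_algebra.
From mathcomp Require Import zify ring.
From Stdlib Require Import Classical.

Set Implicit Arguments.
Unset Strict Implicit.
Unset Printing Implicit Defensive.

Import GRing.Theory.
Local Open Scope ring_scope.

(** The trace of a sum of idempotents lies in the prime field. Conversely, let
    [H] be a Hessenberg matrix with no zero on its superdiagonal and with trace
    in the prime field. Up to similarity, all its rows but the last are those of
    a bidiagonal matrix [Q1 + Q2] with diagonal [1, ..., 1], where [Q1] and [Q2]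
    are the idempotents carrying the even and the odd rows. The first diagonal
    entry may be raised by 1 and the last one lowered by 1, so that the trace of
    [Q1 + Q2] takes three consecutive values. As [p <= 3], it can be chosen so
    that the remaining last row has trace 1, hence is idempotent: [H] is a sum
    of three idempotents. If the superdiagonal of [H] has isolated zeros, they
    are first filled by subtracting a fourth idempotent.
    Every endomorphism has a basis consisting of successive Krylov chains of
    length at least 2, each modulo the previous ones, followed by eigenvectors
    for a single eigenvalue [lam]. One may put one eigenvector first and one
    last and still have isolated zeros only, so at most 2 eigenvectors are
    absorbed; the others are split off in groups of [p], using that [lam%:M] of
    size [p] is a sum of four idempotents. *)

(** * Krylov bases *)

Section KrylovBasis.
Variables (K : fieldType) (vT : vectType K) (f : 'End(vT)).
Implicit Types (U l s E : seq vT) (u v w x y e : vT) (T : {vspace vT}).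

(* [l] is a Krylov chain modulo the span of [U], up to triangular corrections;
   [head 0] makes the last vector of [l] be mapped into the span of [U ++ l]. *)
Fixpoint link U l : Prop :=
  if l is v :: l' then
    f v - head 0 l' \in <<rcons U v>>%VS /\ link (rcons U v) l'
  else True.

(** Blocks have length at least 2 so that the missing links at the ends of successive blocks are
    never adjacent. *)
Inductive good : seq vT -> Prop :=
| good_nil : good [::]
| good_block U l : good U -> (1 < size l)%N -> link U l -> good (U ++ l).

Lemma span_rcons U v : <<rcons U v>>%VS = (<<U>> + <[v]>)%VS.
Proof. by rewrite -cats1 span_cat span_seq1. Qed.

Lemma linkS U U' l : (<<U>> <= <<U'>>)%VS -> link U l -> link U' l.
Proof.
elim: l U U' => //= v l IHl U U' sUU' [fv lk].
have sv : (<<rcons U v>> <= <<rcons U' v>>)%VS by rewrite !span_rcons addvS.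
by split; [apply: (subvP sv) | apply: IHl lk].
Qed.

Lemma link_nth U l i : link U l -> (i < size l)%N ->
  f l`_i - l`_i.+1 \in <<U ++ take i.+1 l>>%VS.
Proof.
elim: l U i => //= v l IHl U [|i] [fv lk] lt_i.
  by rewrite take0 cats1 nth0.
by rewrite -cat_rcons; apply: IHl.
Qed.

Lemma link_subv U l T : link U l -> (<<U>> <= T)%VS ->
  (forall v, v \in l -> v \in T -> f v \in T) ->
  (l != [::] -> head 0 l \in T) -> (<<U ++ l>> <= T)%VS.
Proof.
elim: l U => [|v l IHl] U; first by rewrite cats0.
move=> [fv lk] sUT fT /(_ isT) vT'; rewrite -cat_rcons.
have sUvT : (<<rcons U v>> <= T)%VS by rewrite span_rcons subv_add sUT -memvE.
apply: IHl => // [x xl|_]; first by apply: fT; rewrite inE xl orbT.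
have -> : head 0 l = f v - (f v - head 0 l) by rewrite opprB addrC subrK.
by apply: memvB; [apply: fT; rewrite ?mem_head | apply: (subvP sUvT)].
Qed.

Lemma good_stable U v : good U -> v \in <<U>>%VS -> f v \in <<U>>%VS.
Proof.
move=> gU; elim: gU v => [|{}U l gU IH lt1l lk] v.
  by rewrite span_nil memv0 => /eqP->; rewrite linear0 mem0v.
move=> /(coord_span (X := in_tuple (U ++ l)))->; rewrite linear_sum memv_suml // => i _.
rewrite linearZ memvZ //; set x := _`_i.
have: x \in U ++ l by rewrite mem_nth.
rewrite mem_cat => /orP[xU|xl].
  by rewrite span_cat (subvP (addvSl _ _)) // IH // memv_span.
have lti : (index x l < size l)%N by rewrite index_mem.
have /= := link_nth lk lti; rewrite nth_index // => fx.
rewrite -[f x](subrK (l`_(index x l).+1)) memvD //.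
  apply: subvP fx; apply: sub_span => z; rewrite !mem_cat.
  by case/orP=> [->//|/mem_take->]; rewrite orbT.
case: (ltnP (index x l).+1 (size l)) => [lt|ge]; last by rewrite nth_default ?mem0v.
by rewrite memv_span // mem_cat mem_nth ?orbT.
Qed.

(* With [l] the last block, write [f w - lam *: w] as [u + c *: head 0 l + g y]
   where [u] is in the span of [U], [y] in that of [U ++ l], and
   [g := f - lam *: \1]. If [c] is nonzero, then [w - y], rescaled, extends [l]
   at its head; otherwise [w - y] can be handled with [U] alone. *)
Lemma good_extend U w (lam : K) : good U -> w \notin <<U>>%VS ->
    f w - lam *: w \in <<U>>%VS ->
  (exists2 x, x \in <<U>>%VS & f (w - x) = lam *: (w - x)) \/
  (exists U', [/\ good U', size U' = (size U).+1 &
                  <<U'>>%VS = (<<U>> + <[w]>)%VS]).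
Proof.
move=> gU; elim: gU w => [|{}U l gU IH lt1l lk] w wU fw.
  left; exists 0; rewrite ?mem0v // subr0.
  by apply/eqP; rewrite -subr_eq0 -memv0 -span_nil.
pose g := (f - lam *: \1)%VF.
have gE x : g x = f x - lam *: x by rewrite add_lfunE opp_lfunE scale_lfunE id_lfunE.
pose S := <<U ++ l>>%VS.
(* The block is generated from its head by [f] modulo [U], and [f v = g v + lam *: v] keeps each of
   its vectors inside the right-hand side. *)
have sS : (S <= <<U>> + (<[head 0%R l]> + g @: S))%VS.
  apply: link_subv lk (addvSl _ _) _ _ => [v vl vT'|_].
    rewrite -[f v](subrK (lam *: v)) memvD ?memvZ // -gE.
    apply: (subvP (addvSr _ _)); apply: (subvP (addvSr _ _)).
    by apply: memv_img; rewrite memv_span // mem_cat vl orbT.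
  apply: (subvP (addvSr _ _)); apply: (subvP (addvSl _ _)).
  exact: memv_line.
have /memv_addP[u uU [x /memv_addP[a /vlineP[c ac] [b /memv_imgP[y yS by_] xab]] E0]] :=
  subvP sS _ fw.
have E : f w - lam *: w = u + (c *: head 0 l + g y) by rewrite E0 xab ac by_.
have fwy : f (w - y) - lam *: (w - y) = u + c *: head 0 l.
  by rewrite -gE linearB /= !gE E gE addrA addrK.
have wyS : w - y \notin S by apply: contra wU => h; rewrite -[w](subrK y) memvD.
have wS : (S + <[w]> = S + <[w - y]>)%VS.
  apply/eqP; rewrite eqEsubv !subv_add !addvSl /= -!memvE; apply/andP; split.
    have ywy : y + (w - y) \in (S + <[w - y]>)%VS by rewrite memv_add ?memv_line.
    by rewrite addrCA subrr addr0 in ywy.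
  by rewrite [w - y]addrC memv_add ?memv_line ?memvN.
have [c0|c_neq0] := eqVneq c 0.
  rewrite c0 scale0r addr0 in fwy.
  have wyU : w - y \notin <<U>>%VS.
    by apply: contra wyS; apply: subvP; rewrite /S span_cat addvSl.
  case: (IH (w - y) wyU) => [|[z zU Ez]|[U' [gU' sz sp]]]; first by rewrite fwy.
    left; exists (y + z); last by rewrite opprD addrA.
    by rewrite memvD // span_cat (subvP (addvSl _ _)).
  right; exists (U' ++ l); split; last 1 first.
  - by rewrite wS /S !span_cat sp -!addvA [(<<l>> + _)%VS]addvC.
  - by apply: good_block => //; apply: linkS lk; rewrite sp addvSl.
  by rewrite !size_cat sz.
right; exists (U ++ (c^-1 *: (w - y)) :: l); split; last 1 first.
- rewrite wS /S span_cat span_cons span_cat [(<[_]> + <<l>>)%VS]addvC -addvA.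
  congr (_ + (_ + _))%VS; apply/eqP; rewrite eqEsubv -!memvE.
  rewrite memvZ ?memv_line //= -[w - y in X in X \in _]scale1r -(divff c_neq0).
  by rewrite -scalerA memvZ ?memv_line.
- apply: good_block => //=; first exact: ltnW.
  split; last by apply: linkS lk; rewrite span_rcons addvSl.
  move: (w - y) fwy => z fwy; rewrite linearZ /= -[f z](subrK (lam *: z)) fwy.
  rewrite !scalerDr !scalerA mulVf // scale1r addrAC addrK [_^-1 * _]mulrC -scalerA.
  by rewrite span_rcons; apply: memv_add; rewrite memvZ ?memv_line.
by rewrite !size_cat /= addnS.
Qed.

Lemma free_size s : free s -> (size s <= \dim {:vT})%N.
Proof. by rewrite /free => /eqP <-; apply/dimvS/subvf. Qed.

Lemma free_rcons U v : free (rcons U v) = (v \notin <<U>>%VS) && free U.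
Proof. by rewrite (perm_free (Y := v :: U)) ?free_cons ?perm_rcons. Qed.

Lemma link_exists U v : free (rcons U v) ->
  exists l, link U (v :: l) /\ free (U ++ v :: l).
Proof.
have [k] := ubnP (\dim {:vT} - size U); elim: k U v => // k IHk U v ltk fr.
case: (boolP (f v \in <<rcons U v>>%VS)) => fv.
  by exists [::]; rewrite cats1 /= subr0.
have fr' : free (rcons (rcons U v) (f v)) by rewrite free_rcons fv.
case: (IHk (rcons U v) (f v)) => // [|l [lk fl]].
  have := free_size fr; rewrite size_rcons; move: ltk.
  by move=> h1 h2; rewrite -ltnS (leq_trans _ h1) // ltnS ltn_sub2l.
by exists (f v :: l); rewrite -cat_rcons; split => //; split; rewrite /= ?subrr ?mem0v.
Qed.

(** Modulo [U] every vector is an eigenvector; comparing the eigenvalues of [v0], [w] and [v0 + w]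
    shows that they all coincide. *)
Lemma scalar_mod U : (forall v, v \in <<U>>%VS -> f v \in <<U>>%VS) ->
    (forall v, f v \in <<rcons U v>>%VS) ->
  exists lam, forall v, f v - lam *: v \in <<U>>%VS.
Proof.
move=> stU fU.
have fU' v : exists lam, f v - lam *: v \in <<U>>%VS.
  have := fU v; rewrite span_rcons => /memv_addP[u uU [_ /vlineP[c ->] ->]].
  by exists c; rewrite addrK.
have [full|/subvPn[v0 _ v0U]] := boolP ({:vT} <= <<U>>)%VS.
  by exists 0 => v; apply: (subvP full); apply: memvf.
have [lam flam] := fU' v0; exists lam => w.
have [wv0|wv0] := boolP (w \in <<rcons U v0>>%VS).
  move: wv0; rewrite span_rcons => /memv_addP[u uU [_ /vlineP[c ->] ->]].
  rewrite linearD linearZ scalerDr opprD addrACA /=.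
  rewrite [lam *: (c *: v0)]scalerA mulrC -scalerA -scalerBr.
  by rewrite memvD ?memvZ // memvB ?stU ?memvZ.
have unscale T k x : k != 0 -> k *: x \in T -> x \in T.
  by move=> k0 /(memvZ k^-1); rewrite scalerA mulVf // scale1r.
have [mu fmu] := fU' w; have [nu fnu] := fU' (v0 + w).
have vw : (lam - nu) *: v0 + (mu - nu) *: w \in <<U>>%VS.
  have := memvB fnu (memvD flam fmu);
  rewrite [X in X \in _](_ : _ = (lam - nu) *: v0 + (mu - nu) *: w) //.
  rewrite linearD /= scalerDr !scalerBl.
  rewrite [X in _ - X]addrACA -opprD opprB [LHS]addrC addrA subrK.
  by rewrite opprD addrACA.
have munu : mu = nu.
  apply: contraNeq wv0; rewrite -subr_eq0 => munu.
  apply: (unscale _ _ _ munu); rewrite span_rcons.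
  rewrite -[X in X \in _](addKr ((lam - nu) *: v0)) addrC.
  by rewrite memv_add // -scaleNr memvZ ?memv_line.
have lamnu : lam = nu.
  apply: contraNeq v0U; rewrite -subr_eq0 => lamnu.
  by rewrite munu subrr scale0r addr0 in vw; apply: unscale vw.
by rewrite lamnu -munu.
Qed.

(** While some [f v] lies outside the span of [U] and [v], a block starting with [v, f v] can be
    added. When none does, [scalar_mod] applies. *)
Lemma good_mod_scalar : exists U lam,
  [/\ good U, free U & forall v, f v - lam *: v \in <<U>>%VS].
Proof.
suff H k U : good U -> free U -> (\dim {:vT} - size U < k)%N -> exists U lam,
    [/\ good U, free U & forall v, f v - lam *: v \in <<U>>%VS].
  by apply: (H _ [::] good_nil (nil_free _)) (ltnSn _).
elim: k U => // k IHk U gU frU ltk.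
have stU v : v \in <<U>>%VS -> f v \in <<U>>%VS by apply: good_stable.
have [[v fv]|nex] := classic (exists v, f v \notin <<rcons U v>>%VS); last first.
  have [v|lam Hlam] := scalar_mod stU; last by exists U, lam.
  by apply/negPn/negP => fv; apply: nex; exists v.
have vU : v \notin <<U>>%VS.
  apply: contra fv => /stU; apply: subvP; rewrite span_rcons; apply: addvSl.
have fr : free (rcons (rcons U v) (f v)) by rewrite !free_rcons fv vU.
have [l [lk frl]] := link_exists fr.
have gU' : good (U ++ [:: v, f v & l]).
  by apply: good_block => //; split=> //; rewrite subrr mem0v.
rewrite cat_rcons in frl; apply: (IHk _ gU' frl).
have := free_size frl; rewrite size_cat /=; lia.
Qed.

(** By [good_extend], a vector outside the current span yields either a new eigenvector for [E] or a
    [U] longer by one, so the codimension drops. *)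
Lemma split_scalar U E lam : good U -> free (U ++ E) ->
    {in E, forall e, f e = lam *: e} ->
    (forall v, f v - lam *: v \in <<U>>%VS) ->
  exists U' E', [/\ good U', free (U' ++ E'), <<U' ++ E'>>%VS = fullv &
    {in E', forall e, f e = lam *: e}].
Proof.
have [k] := ubnP (\dim {:vT} - size (U ++ E)); elim: k U E => // k IHk U E ltk.
move=> gU fr eigE fU.
have [full|/subvPn[w _ wUE]] := boolP ({:vT} <= <<U ++ E>>)%VS.
  by exists U, E; split=> //; apply/eqP; rewrite eqEsubv subvf.
have frw : free (w :: U ++ E) by rewrite free_cons wUE.
have {}ltk : (\dim {:vT} - (size (U ++ E)).+1 < k)%N.
  by rewrite -ltnS (leq_trans _ ltk) // ltnS ltn_sub2l // (leq_trans _ (free_size frw)).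
have wU : w \notin <<U>>%VS.
  by apply: contra wUE; apply: subvP; rewrite span_cat addvSl.
have [[x xU fwx]|[U' [gU' szU' spU']]] := good_extend gU wU (fU w).
  apply: (IHk U (w - x :: E)) => //.
  - by rewrite size_cat /= addnS -size_cat.
  - rewrite (perm_free (Y := (w - x) :: U ++ E)) ?perm_catCA //.
      rewrite free_cons fr andbT; apply: contra wUE => h.
      rewrite -[w](subrK x) memvD // span_cat; apply: subvP xU; apply: addvSl.
    by rewrite -cat1s perm_catCA.
  by move=> e; rewrite inE => /predU1P[->//|/eigE].
apply: (IHk U' E) => //.
- by rewrite size_cat szU' addSn -size_cat.
- have sp : <<U' ++ E>>%VS = <<w :: U ++ E>>%VS.
    by rewrite !(span_cat, span_cons) spU' [(<<U>> + _)%VS]addvC -addvA.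
  move: frw; rewrite /free sp => /eqP->.
  by rewrite /= !size_cat szU'.
by move=> v; apply: subvP (fU v); rewrite spU' addvSl.
Qed.

Lemma eigen_link U e lam : f e = lam *: e -> link U [:: e].
Proof.
move=> fe; rewrite /= subr0 fe span_rcons -[_ *: e]add0r.
by rewrite memv_add ?mem0v ?memvZ ?memv_line.
Qed.

(* [c i] tells whether [s`_i] is linked to [s`_i.+1]. No two consecutive links
   are missing, where for [b = 0] the missing link after the last vector counts
   too, so that a further block can be appended. *)
Definition chain b s := exists c : nat -> bool,
  [/\ forall i, (i < size s)%N ->
        f s`_i - (c i)%:R *: s`_i.+1 \in <<take i.+1 s>>%VS,
      forall i, (size s <= i.+1)%N -> c i = false &
      forall i, (i.+1 + b < size s)%N -> c i || c i.+1].

Lemma chainW s : chain 0 s -> chain 1 s.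
Proof.
case=> c [h1 h2 h3]; exists c; split=> // i lti; apply: h3.
by rewrite addn0; apply: leq_trans lti; rewrite addn1.
Qed.

(** The link from the end of [s] to [l] is missing. If [l] is a single vector, the missing link
    after it comes next, which only [chain 1] tolerates. *)
Lemma chain_cat s l : chain 0 s -> l != [::] -> link s l ->
  chain (size l == 1) (s ++ l).
Proof.
case=> c [h1 h2 h3] l0 lk.
have {}l0 : (0 < size l)%N by case: l l0 {lk}.
exists (fun i => if (i < size s)%N then c i else (i.+1 < size s + size l)%N).
split=> i; rewrite ?size_cat.
- move=> lti; rewrite nth_cat take_cat; case: ltnP => [ltis|leis].
    rewrite nth_cat; have [lt'|le'] := ltnP i.+1 (size s); first exact: h1.
    have eqi : i.+1 = size s by apply/eqP; rewrite eqn_leq ltis le'.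
    have := h1 i ltis.
    rewrite h2 // !scale0r eqi subnn take0 cats0 take_size //.
  rewrite [(i.+1 < size s)%N]ltnNge leqW //= subSn // nth_cat.
  rewrite [(i.+1 < size s)%N]ltnNge leqW //= subSn //.
  have lt' : (i - size s < size l)%N by rewrite ltn_subLR.
  have := link_nth lk lt'; case: ltnP => [_|le]; first by rewrite scale1r.
  by rewrite scale0r [l`_(_).+1]nth_default // -subSn // leq_subRL // ?leqW.
- move=> le; case: ltnP => [lti|_]; last by rewrite ltnNge le.
  by apply: h2; apply: leq_trans le; apply: leq_addr.
move=> lti; have [ltis|leis] := ltnP i.+1 (size s).
  by rewrite (ltnW ltis) h3 // addn0.
have lti2 : (i.+1 < size s + size l)%N by apply: leq_ltn_trans lti; apply: leq_addr.
have [ltis|leis'] := ltnP i (size s); last by rewrite lti2.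
have eqi : i.+1 = size s by apply/eqP; rewrite eqn_leq ltis leis.
move: lti; rewrite eqi ltn_add2l => lt; apply/orP; right.
by rewrite -addn1 ltn_add2l; case: (size l) l0 lt => [|[|m]].
Qed.

Lemma chain_good s U : chain 0 s -> good U -> chain 0 (s ++ U).
Proof.
move=> ch; elim=> [|{}U l _ IH lt1l lk]; first by rewrite cats0.
rewrite catA -[0%N]/(nat_of_bool false) -(gtn_eqF lt1l).
apply: chain_cat => //; first by case: l lt1l {lk}.
by apply: linkS lk; rewrite span_cat addvSr.
Qed.

Lemma chain_decomposition p : (0 < p <= 3)%N ->
  exists s E lam q, [/\ chain 1 s, size E = (q * p)%N, free (s ++ E),
    <<s ++ E>>%VS = fullv & {in E, forall e, f e = lam *: e}].
Proof.
case/andP=> p_gt0 p_le3.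
have [U0 [lam [gU0 frU0 fU0]]] := good_mod_scalar.
have [|//|U [E [gU fr sp eigE]]] := @split_scalar U0 [::] lam gU0 _ _ fU0.
  by rewrite cats0.
(* [r <= 2] eigenvectors are absorbed into the chain, leaving a multiple of [p] for the scalar
   part. *)
pose r := (size E %% p)%N.
suff [s ch pm] : exists2 s, chain 1 s & perm_eq s (U ++ take r E).
  have pm' : perm_eq (s ++ drop r E) (U ++ E).
    by rewrite -[in X in perm_eq _ X](cat_take_drop r E) catA perm_cat2r.
  exists s, (drop r E), lam, (size E %/ p)%N; split=> //.
  - by rewrite size_drop {1}(divn_eq (size E) p) addnK.
  - by rewrite (perm_free pm').
  - by rewrite -sp; apply: eq_span; apply: perm_mem.
  - by move=> e /mem_drop; apply: eigE.
have szt : (size (take r E) <= 2)%N.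
  by rewrite size_take_min geq_min -ltnS (leq_trans _ p_le3) // ltn_mod.
have {}eigE : {in take r E, forall e, f e = lam *: e}.
  by move=> e /mem_take; apply: eigE.
have ch0 : chain 0 [::] by exists (fun=> false); split.
case: (take r E) szt eigE => [|e [|e' [|//]]] _ eigE.
- by exists U; rewrite ?cats0 //; apply/chainW/(chain_good ch0 gU).
- exists (U ++ [:: e]) => //; apply: (chain_cat (chain_good ch0 gU)) => //.
  by apply: eigen_link; apply: eigE; rewrite mem_head.
exists ((e :: U) ++ [:: e']).
  apply: chain_cat => //; last by apply: eigen_link; apply: eigE; rewrite !inE eqxx orbT.
  apply: (@chain_good [:: e] U) => //; exists (fun=> false); split=> // -[|//] _.
  rewrite scale0r; apply: (@link_nth [::] [:: e] 0) => //.
  by apply: eigen_link; apply: eigE; rewrite mem_head.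
by rewrite -cat1s -catA perm_catCA.
Qed.

End KrylovBasis.

(** * Sums of idempotents *)

Section SumsOfIdempotents.
Variable K : fieldType.

(** In a rank factorization [Q = C *m B], idempotence forces [B *m C = 1%:M], so the trace is the
    rank. *)
Lemma idempotent_trace n (Q : 'M[K]_n) :
  idempotent_mx Q -> exists r : nat, \tr Q = r%:R.
Proof.
rewrite /idempotent_mx => QQ; exists (\rank Q); move: QQ.
rewrite -{-5}(mulmx_base Q).
have := row_base_free Q; have := col_base_full Q.
move: (\rank Q) (col_base Q) (row_base Q) => r C B.
move=> /row_fullP[L LC] /row_freeP[R BR] E.
have BC : B *m C = 1%:M.
  have := congr1 (fun M => L *m (M *m R)) E; cbv beta.
  by rewrite -!mulmxA BR mulmx1 LC mulmxA LC mul1mx.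
by rewrite mxtrace_mulC BC mxtrace1.
Qed.

Lemma sum_of_idempotents_trace n k (A : 'M[K]_n) :
  sum_of_idempotents k A -> exists t : nat, \tr A = t%:R.
Proof.
case=> Q [idQ ->]; rewrite raddf_sum /=.
apply: (big_ind (fun x => exists t : nat, x = t%:R)) => [|x y|i _].
- by exists 0%N.
- by move=> [s ->] [t ->]; exists (s + t)%N; rewrite natrD.
exact: idempotent_trace.
Qed.

Lemma sum_of_idempotents0 n : sum_of_idempotents 0 (0 : 'M[K]_n).
Proof. by exists (fun=> 0); split=> [[]//|]; rewrite big_ord0. Qed.

Lemma sum_of_idempotentsS n k (P B : 'M[K]_n) : idempotent_mx P ->
  sum_of_idempotents k B -> sum_of_idempotents k.+1 (P + B).
Proof.
move=> idP [Q [idQ ->]].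
exists (fun i => oapp Q P (unlift ord0 i)); split=> [i|].
  by case: unliftP => [j|] _ /=.
rewrite big_ord_recl unlift_none /=; congr (_ + _).
by apply: eq_bigr => i _; rewrite liftK.
Qed.

(** Two sizes are allowed because a basis of ['rV_n] may be indexed by a size not convertible to
    [n]. *)
Lemma sum_of_idempotents_conj m n k (B : 'M[K]_(m, n)) (C : 'M[K]_(n, m)) X :
  B *m C = 1%:M -> sum_of_idempotents k X ->
  sum_of_idempotents k (C *m X *m B).
Proof.
move=> BC [Q [idQ ->]]; exists (fun i => C *m Q i *m B); split=> [i|].
  rewrite /idempotent_mx -!mulmxA [B *m (C *m _)]mulmxA BC mul1mx.
  by rewrite [Q i *m (Q i *m _)]mulmxA idQ.
by rewrite mulmx_sumr mulmx_suml.
Qed.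

Lemma sum_of_idempotents_block m n k (X : 'M[K]_m) (Y : 'M[K]_n) :
  sum_of_idempotents k X -> sum_of_idempotents k Y ->
  sum_of_idempotents k (block_mx X 0 0 Y).
Proof.
move=> [Q [idQ ->]] [R [idR ->]].
exists (fun i => block_mx (Q i) 0 0 (R i)); split=> [i|].
  by rewrite /idempotent_mx mulmx_block !mulmx0 !mul0mx !addr0 !add0r idQ idR.
apply: (big_rec3 (fun X Y Z => block_mx X 0 0 Y = Z)) => [|i x y z _ <-].
  by apply/eqP; rewrite block_mx_eq0 !eqxx.
by rewrite add_block_mx !addr0.
Qed.

(** With the indices in [D] listed first, [Q] has identity and arbitrary blocks on top, zero rows
    below. *)
Lemma idempotent_rows n (D : pred 'I_n) (Q : 'M[K]_n) :
    (forall i j, ~~ D i -> Q i j = 0) ->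
    (forall i j, D i -> D j -> Q i j = (i == j)%:R) ->
  idempotent_mx Q.
Proof.
move=> Q0 Q1; apply/matrixP => i j; rewrite mxE.
have [Di|nDi] := boolP (D i); last first.
  by rewrite Q0 // big1 // => k _; rewrite Q0 ?mul0r.
rewrite (bigD1 i) //= Q1 // eqxx mul1r big1 ?addr0 // => k ki.
have [Dk|nDk] := boolP (D k); last by rewrite (Q0 k) ?mulr0.
by rewrite Q1 // eq_sym (negPf ki) mul0r.
Qed.

(** [x] raises the first diagonal entry of [Q1 + Q2] and [y] lowers the last, giving trace
    [n.+1%:R + x%:R - y%:R]; exactly 1 is left for the third idempotent. *)
Lemma unreduced_three_idempotents n (H : 'M[K]_n.+1) (x y : bool) :
    (forall i j : 'I_n.+1, (i.+1 < j)%N -> H i j = 0) ->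
    (forall i j : 'I_n.+1, j = i.+1 :> nat -> H i j != 0) ->
    \tr H = n.+2%:R + x%:R - y%:R ->
  sum_of_idempotents 3 H.
Proof.
move=> H0 H1 trH.
pose d (i : nat) : K := 1 + (x && (i == 0))%:R.
(* By construction [w i *m H = d i *: w i + w i.+1], the desired bidiagonal rows. These vectors form
   a triangular matrix whose diagonal entries are products of superdiagonal entries of [H]. *)
pose w := fix w i : 'rV[K]_n.+1 :=
  if i is i'.+1 then w i' *m (H - (d i')%:M) else delta_mx 0 0.
have wS i : w i.+1 = w i *m H - d i *: w i.
  by rewrite /= mulmxBr mul_mx_scalar.
have w0 i (j : 'I_n.+1) : (i < j)%N -> w i 0 j = 0.
  elim: i j => [|i IHi] j ltij; first by rewrite mxE /= -val_eqE gtn_eqF.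
  rewrite wS !mxE IHi 1?ltnW // mulr0 subr0 big1 // => k _.
  have [ltik|leki] := ltnP i k; first by rewrite IHi // mul0r.
  by rewrite H0 ?mulr0 // (leq_ltn_trans _ ltij).
have w1 (i : 'I_n.+1) : w i 0 i != 0.
  case: i; elim=> [|i IHi] lti; first by rewrite mxE /= oner_eq0.
  have lti' := ltnW lti.
  rewrite wS !mxE (w0 i) //= mulr0 subr0 (bigD1 (Ordinal lti')) //= big1 ?addr0.
    by apply: mulf_neq0; [apply: IHi | apply: H1].
  move=> k; rewrite -val_eqE /= => nik; have [ltik|leki] := ltnP i k.
    by rewrite w0 // mul0r.
  by rewrite H0 ?mulr0 //= ltnS ltn_neqAle nik.
pose W := \matrix_(i < n.+1) w i.
have unitW : W \in unitmx.
  rewrite unitmxE det_trig.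
    by rewrite unitfE; apply/prodf_neq0 => i _; rewrite mxE.
  by apply/is_trig_mxP => i j ltij; rewrite mxE w0.
(* The off-diagonal 1 of a row lies in a column of opposite parity, and never in column 0, so
   [idempotent_rows] applies even when [Q2] also takes row 0. *)
pose Q1 : 'M[K]_n.+1 := \matrix_(i, j)
  if ~~ odd i && ~~ (y && (i == ord_max)) then (i == j)%:R + (j == i.+1 :> nat)%:R else 0.
pose Q2 : 'M[K]_n.+1 := \matrix_(i, j)
  if odd i && ~~ (y && (i == ord_max)) then (i == j)%:R + (j == i.+1 :> nat)%:R
  else if x && (i == ord0) then (i == j)%:R else 0.
have idQ1 : idempotent_mx Q1.
  apply: (@idempotent_rows _ [pred i : 'I_n.+1 | ~~ odd i && ~~ (y && (i == ord_max))]).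
    by move=> i j /= /negPf; rewrite mxE => ->.
  move=> i j /= Di Dj; rewrite mxE Di; case: (nat_of_ord j =P i.+1) => [Eji|_].
    by move: Di Dj; rewrite Eji /= negbK; case: odd.
  by rewrite addr0.
have idQ2 : idempotent_mx Q2.
  apply: (@idempotent_rows _ [pred i : 'I_n.+1 |
      odd i && ~~ (y && (i == ord_max)) || x && (i == ord0)]).
    by move=> i j /=; rewrite negb_or mxE => /andP[/negPf-> /negPf->].
  move=> i j /= Di Dj; rewrite mxE; case: ifP Di => /= [Di _|_ ->//].
  case: (nat_of_ord j =P i.+1) => [Eji|_]; last by rewrite addr0.
  have j0 : (j == ord0) = false by rewrite -val_eqE /= Eji.
  by move: Dj; rewrite j0 Eji /= andbF orbF; case/andP: Di => ->.
pose M := W *m H *m invmx W.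
pose C := M - (Q1 + Q2).
have C0 i j : i != ord_max -> C i j = 0.
  move=> nim; have lti : (i < n)%N.
    by rewrite ltn_neqAle -val_eqE -ltnS ltn_ord andbT in nim *.
  suff -> : C = (W *m H - (Q1 + Q2) *m W) *m invmx W.
    have EW : row i (W *m H - (Q1 + Q2) *m W) = 0.
      rewrite linearB /= !row_mul rowK.
      have -> : row i (Q1 + Q2) =
          d i *: delta_mx 0 i + delta_mx 0 (Ordinal (lti : i.+1 < n.+1)%N).
        apply/rowP => k; rewrite !mxE (negPf nim) andbF /= !andbT /d /=.
        have -> : (k == Ordinal (lti : i.+1 < n.+1)%N) = (k == i.+1 :> nat) by [].
        have -> : (i == ord0) = (i == 0 :> nat) by [].
        rewrite [k == i]eq_sym.
        case: (boolP (odd i)) => oi /=.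
          have -> : (i == 0 :> nat) = false by case: (nat_of_ord i) oi.
          by rewrite andbF addr0 add0r mul1r.
        case: (x && _); last by rewrite !addr0 mul1r.
        by rewrite mulrDl mul1r addrAC.
      rewrite mulmxDl -scalemxAl -!rowE !rowK /=.
      by rewrite mulmxBr mul_mx_scalar [d i *: _ + _]addrC subrK subrr.
    transitivity (row i ((W *m H - (Q1 + Q2) *m W) *m invmx W) 0 j).
      by rewrite [RHS]mxE.
    by rewrite row_mul EW mul0mx mxE.
  by rewrite mulmxBl mulmxK.
(* Only the last row of [C] is nonzero, so its diagonal entry there is the trace, which is 1. *)
have idC : idempotent_mx C.
  apply: (@idempotent_rows _ (pred1 ord_max)) => [i j|_ _ /eqP-> /eqP->]; first exact: C0.
  rewrite eqxx.
  have <- : \tr C = C ord_max ord_max.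
    by rewrite /mxtrace (bigD1 ord_max) //= big1 ?addr0 // => i; apply: C0.
  rewrite /C linearB /= /M -mulmxA mxtrace_mulC mulmxKV // trH.
  have -> : \tr (Q1 + Q2) = n.+1%:R + x%:R - y%:R.
    have -> : \tr (Q1 + Q2) =
        \sum_(i < n.+1) (1 + (x && (i == ord0))%:R - (y && (i == ord_max))%:R).
      apply: eq_bigr => i _; rewrite !mxE eqxx ltn_eqF // addr0.
      case: (boolP (odd i)) => oi /=.
        have -> : (i == ord0) = false by rewrite -val_eqE /=; case: (nat_of_ord i) oi.
        by rewrite andbF addr0; case: (y && _) => /=; rewrite ?subrr ?subr0 ?addr0 ?add0r.
      by case: (y && _); case: (x && _) => /=; ring.
    rewrite sumrB big_split /= sumr_const card_ord; congr (_ + _ - _).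
      rewrite (bigD1 ord0) //= eqxx andbT big1 ?addr0 // => i /negPf->.
      by rewrite andbF.
    rewrite (bigD1 ord_max) //= eqxx andbT big1 ?addr0 // => i /negPf->.
    by rewrite andbF.
  by rewrite -natr1; ring.
have EM : Q1 + (Q2 + (C + 0)) = M by rewrite addr0 addrA addrC subrK.
have -> : H = invmx W *m (Q1 + (Q2 + (C + 0))) *m W.
  by rewrite EM !mulmxA mulVmx // mul1mx mulmxKV.
apply: sum_of_idempotents_conj; first by rewrite mulmxV.
by do 3!apply: sum_of_idempotentsS => //; apply: sum_of_idempotents0.
Qed.

(** The residues are 0, 1 and, for [p = 3], also 2, which equals -1. *)
Lemma natr_pchar_le3 p : p \in [pchar K] -> (p <= 3)%N ->
  forall t : nat, exists x y : bool, t%:R = x%:R - y%:R :> K.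
Proof.
move=> charKp p_le3 t; have p0 := pcharf0 charKp.
rewrite -(GRing.natr_mod_pchar charKp).
have ltm : (t %% p < p)%N by rewrite ltn_mod (prime_gt0 (pcharf_prime charKp)).
case: (t %% p)%N ltm => [|[|[|m]]] ltm.
- by exists false, false; rewrite subr0.
- by exists true, false; rewrite subr0.
- exists false, true; have p3 : p = 3%N by apply/eqP; rewrite eqn_leq p_le3.
  by rewrite p3 in p0; apply/eqP; rewrite sub0r -addr_eq0 natr1 p0.
by have := leq_trans ltm p_le3.
Qed.

Lemma hessenberg_four_idempotents p n (H : 'M[K]_n) (c : nat -> bool) :
    p \in [pchar K] -> (p <= 3)%N ->
    (forall i j : 'I_n, (i.+1 < j)%N -> H i j = 0) ->
    (forall i j : 'I_n, j = i.+1 :> nat -> H i j = (c i)%:R) ->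
    (forall i, (i.+2 < n)%N -> c i || c i.+1) ->
    (exists t : nat, \tr H = t%:R) ->
  sum_of_idempotents 4 H.
Proof.
case: n H => [|n] H charKp p_le3 H0 H1 cc [t trH].
  exists (fun=> 0); split=> [i|]; first by rewrite /idempotent_mx mulmx0.
  by rewrite [H]flatmx0 [RHS]flatmx0.
(* The last row is left out: it has no superdiagonal entry, and the link before it may be missing
   too. *)
pose D (i : nat) := (i < n)%N && ~~ c i.
pose P : 'M[K]_n.+1 := \matrix_(i, j)
  if D i then (i == j)%:R + (j == i.+1 :> nat)%:R else 0.
have idP : idempotent_mx P.
  apply: (@idempotent_rows _ (fun i => D i)) => [i j /negPf|i j Di Dj].
    by rewrite mxE => ->.
  rewrite mxE Di; case: (nat_of_ord j =P i.+1) => [Eji|_]; last by rewrite addr0.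
  move: Di Dj; rewrite Eji /D => /andP[lti nci] /andP[lti1 nci1].
  by have := cc i lti1; rewrite (negPf nci) (negPf nci1).
have [r trP] := idempotent_trace idP.
have [x [y trE]] : exists x y : bool, \tr (H - P) = n.+2%:R + x%:R - y%:R.
  (* As [p.-1] is -1 in [K], this natural number represents [t - (r + n.+2)]. *)
  have [x [y Exy]] := natr_pchar_le3 charKp p_le3 (t + p.-1 * (r + n.+2)).
  exists x, y; rewrite -addrA -Exy linearB /= trH trP natrD addrCA; congr (_ + _).
  apply/eqP; rewrite eq_sym addrC -addr_eq0 -addrA -natrD.
  have p_gt0 := prime_gt0 (pcharf_prime charKp).
  by rewrite [(n.+2 + r)%N]addnC -natrD -mulSnr prednK // natrM (pcharf0 charKp) mul0r.
rewrite -[H](subrK P) addrC; apply: sum_of_idempotentsS => //.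
apply: (unreduced_three_idempotents (x := x) (y := y)) => // i j.
  move=> ltij; rewrite !mxE H0 // gtn_eqF //.
  have -> : (i == j) = false by rewrite -val_eqE ltn_eqF // ltnW.
  by rewrite addr0 if_same subrr.
(* The superdiagonal of [H - P] has 1 at the links and -1 at the filled zeros. *)
move=> Eji; rewrite !mxE H1 // Eji eqxx.
have -> : (i == j) = false by rewrite -val_eqE /= Eji ltn_eqF.
have lti : (i < n)%N by rewrite -ltnS -Eji ltn_ord.
by rewrite /D lti add0r; case: (c i); rewrite /= ?subr0 ?sub0r ?oppr_eq0 oner_eq0.
Qed.

(** The two adjacent superdiagonal zeros rule out [hessenberg_four_idempotents]. In each explicit
    summand the nontrivial 2 by 2 block has trace 1 and determinant 0; within each pair the
    off-diagonal entries cancel. *)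
Lemma scalar3_four_idempotents (lam : K) : 3%N \in [pchar K] ->
  sum_of_idempotents 4 (lam%:M : 'M[K]_3).
Proof.
move=> char3; have three0 : 3%:R = 0 :> K by apply: pcharf0.
have mod3 (a b k : K) : a = b + 3%:R * k -> a = b by rewrite three0 mul0r addr0.
pose mk (a b c d e g h i j : K) : 'M[K]_3 :=
  \matrix_(r, s) nth 0 (nth [::] [:: [:: a; b; c]; [:: d; e; g]; [:: h; i; j]] r) s.
pose mu := lam + 1.
(* [P1 + P2] and [P3 + P4] are the diagonal matrices with diagonals
   [(mu, 2 - mu, 0)] and [(2, 2 - lam, lam)]. *)
pose P1 := mk (- mu) 1 0  (- mu * (1 + mu)) (1 + mu) 0  0 0 0.
pose P2 := mk (- mu) (- 1) 0  (mu * (1 + mu)) (1 + mu) 0  0 0 0.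
pose P3 := mk 1 0 0  0 (1 + lam) (- lam * (1 + lam))  0 1 (- lam).
pose P4 := mk 1 0 0  0 (1 + lam) (lam * (1 + lam))  0 (- 1) (- lam).
have -> : lam%:M = P1 + (P2 + (P3 + (P4 + 0))).
  apply/matrixP => -[[|[|[|//]]] ?] [[|[|[|//]]] ?]; rewrite !mxE /= /mu;
    rewrite ?mulr1n ?mulr0n; try ring.
  - by apply: (mod3 _ _ lam); ring.
  - by apply: (mod3 _ _ (- lam - 2)); ring.
  - by apply: (mod3 _ _ lam); ring.
have [id1 id2 id3 id4] : [/\ idempotent_mx P1, idempotent_mx P2,
    idempotent_mx P3 & idempotent_mx P4].
  by split; apply/matrixP => -[[|[|[|//]]] ?] [[|[|[|//]]] ?];
    rewrite !mxE !big_ord_recl big_ord0 !mxE /=; ring.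
do 4!apply: sum_of_idempotentsS => //; apply: sum_of_idempotents0.
Qed.

Lemma scalar_four_idempotents p (lam : K) q : p \in [pchar K] -> (p <= 3)%N ->
  sum_of_idempotents 4 (lam%:M : 'M[K]_(q * p)).
Proof.
move=> charKp p_le3.
have sum_p : sum_of_idempotents 4 (lam%:M : 'M[K]_p).
  have: (1 < p)%N by apply/prime_gt1/(pcharf_prime charKp).
  case: p p_le3 charKp => [|[|[|[|//]]]] // _ charKp _; last first.
    exact: scalar3_four_idempotents.
  (* For [p = 2] the single superdiagonal zero is isolated, and the trace [2 * lam] vanishes. *)
  apply: (hessenberg_four_idempotents (c := xpred0) charKp) => // [i j ltij|i j Eji|].
  - by rewrite mxE -val_eqE ltn_eqF // ltnW.
  - by rewrite mxE -val_eqE /= Eji ltn_eqF.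
  exists 0%N; rewrite mxtrace_scalar -[lam *+ _]mulr_natr.
  by rewrite (pcharf0 charKp) mulr0.
elim: q => [|q IHq].
  exists (fun=> 0); split=> [i|]; first by rewrite /idempotent_mx mulmx0.
  by rewrite [lam%:M]flatmx0 [RHS]flatmx0.
have -> : lam%:M = block_mx lam%:M 0 0 lam%:M :> 'M[K]_(p + q * p).
  exact: scalar_mx_block.
exact: sum_of_idempotents_block.
Qed.

End SumsOfIdempotents.

(** * Coordinates in a Krylov basis *)

Lemma coord_take (K : fieldType) (vT : vectType K) (s : seq vT) k x
    (j : 'I_(size s)) :
  free s -> x \in <<take k s>>%VS -> (k <= j)%N -> coord (in_tuple s) j x = 0.
Proof.
move=> frs /(coord_span (X := in_tuple (take k s)))-> lekj.
rewrite linear_sum big1 // => i _; rewrite linearZ /=.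
have ltik : (i < k)%N.
  by apply: leq_trans (ltn_ord i) _; rewrite size_take_min geq_minl.
have ltis : (i < size s)%N by apply: ltn_trans (leq_ltn_trans lekj (ltn_ord j)).
rewrite nth_take // -[s`_i]/((in_tuple s)`_(Ordinal ltis)) coord_free //.
by rewrite -val_eqE /= ltn_eqF ?mulr0 // (leq_trans ltik).
Qed.

Lemma basis_mx_invertible (K : fieldType) n m (t : m.-tuple 'rV[K]_n) :
    free t -> <<t>>%VS = fullv ->
  exists2 C : 'M[K]_(n, m),
    C *m \matrix_(i < m) t`_i = 1%:M & \matrix_(i < m) t`_i *m C = 1%:M.
Proof.
move=> frt spt; exists (\matrix_(i, j) coord t j (delta_mx 0 i)).
  apply/row_matrixP => i; rewrite row_mul row1 mulmx_sum_row.
  rewrite [RHS](coord_span (X := t)) ?spt ?memvf //.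
  by apply: eq_bigr => j _; rewrite rowK !mxE.
apply/matrixP => i j; rewrite !mxE -(coord_free i j frt).
rewrite [in RHS](row_sum_delta t`_i) linear_sum.
by apply: eq_bigr => k _; rewrite linearZ /= !mxE.
Qed.

Theorem proposition10 (K : fieldType) (p : nat) (charKp : p \in [pchar K])
    (p23 : p = 2%N \/ p = 3%N) (n : nat) (n_gt0 : (0 < n)%N) (A : 'M[K]_n)
    (sumA : exists k : nat, sum_of_idempotents k A) :
  sum_of_idempotents 4 A.
Proof.
have p_le3 : (0 < p <= 3)%N by case: p23 => ->.
pose f : 'End('rV[K]_n) := linfun (mulmxr A).
have fE v : f v = v *m A by rewrite lfunE.
have [s [E [lam [q [[c [ch1 _ ch2]] /eqP szE fr sp eigE]]]]] :=
  chain_decomposition f p_le3.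
have frs : free s by apply: catl_free fr.
have [C CB BC] := basis_mx_invertible (t := [tuple of in_tuple s ++ Tuple szE]) fr sp.
pose B1 := \matrix_(i < size s) s`_i.
pose B2 := \matrix_(i < q * p) E`_i.
have EB : \matrix_(i < size s + q * p) (s ++ E)`_i = col_mx B1 B2.
  apply/row_matrixP => i; rewrite rowK -[i]splitK.
  case: (split i) => k /=; rewrite nth_cat.
    by rewrite ltn_ord rowKu rowK.
  by rewrite ltnNge leq_addr /= addKn rowKd rowK.
rewrite /= EB in CB BC.
pose X := \matrix_(i, j < size s) coord (in_tuple s) j (f s`_i).
have fs (i : 'I_(size s)) : f s`_i \in <<s>>%VS.
  rewrite -[f _](subrK ((c i)%:R *: s`_i.+1)) memvD //.
    by apply: subvP (ch1 i (ltn_ord i)); apply: sub_span; apply: mem_take.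
  rewrite memvZ //; have [lt|ge] := ltnP i.+1 (size s).
    by rewrite memv_span ?mem_nth.
  by rewrite nth_default ?mem0v.
have B1A : B1 *m A = X *m B1.
  apply/row_matrixP => i; rewrite !row_mul rowK -fE mulmx_sum_row.
  rewrite [LHS](coord_span (X := in_tuple s)) ?fs //.
  by apply: eq_bigr => j _; rewrite rowK !mxE.
have B2A : B2 *m A = lam%:M *m B2.
  apply/row_matrixP => i; rewrite mul_scalar_mx linearZ /= row_mul rowK -fE.
  by rewrite eigE // mem_nth // (eqP szE).
have EA : A = C *m block_mx X 0 0 lam%:M *m col_mx B1 B2.
  rewrite -mulmxA mul_block_col !mul0mx addr0 add0r -B1A -B2A -mul_col_mx.
  by rewrite mulmxA CB mul1mx.
have [k /sum_of_idempotents_trace[t trA]] := sumA.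
(* The scalar block has size divisible by [p], hence trace 0, so [X] inherits the trace of [A]. *)
have {}trA : \tr X = t%:R.
  rewrite -trA EA -mulmxA mxtrace_mulC -mulmxA BC mulmx1 mxtrace_block.
  by rewrite mxtrace_scalar -mulr_natr natrM (pcharf0 charKp) !mulr0 addr0.
have p3 : (p <= 3)%N by case/andP: p_le3.
rewrite EA; apply: sum_of_idempotents_conj BC _.
apply: sum_of_idempotents_block; last exact: scalar_four_idempotents.
(* Up to the span of the first [i.+1] vectors, [f] maps the vector of index [i] to [c i] times the
   next one, read as 0 past the end. *)
have Xij (i j : 'I_(size s)) : (i < j)%N -> X i j = (c i)%:R * ((j == i.+1 :> nat))%:R.
  move=> ltij; have := coord_take frs (ch1 i (ltn_ord i)) ltij.
  rewrite mxE linearB linearZ /= => /eqP; rewrite subr_eq0 => /eqP->.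
  congr (_ * _); have [ltis|geis] := ltnP i.+1 (size s).
    rewrite -[s`_i.+1]/((in_tuple s)`_(Ordinal ltis)) coord_free //.
    by rewrite -val_eqE eq_sym.
  by rewrite nth_default // linear0 ltn_eqF // (leq_trans (ltn_ord j)).
apply: (hessenberg_four_idempotents (c := c) charKp) => // [i j ltij|i j Eji|i lti|].
- by rewrite Xij ?gtn_eqF ?mulr0 // ltnW.
- by rewrite Xij ?Eji ?eqxx ?mulr1.
- by apply: ch2; rewrite addn1.
by exists t.
Qed.
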